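(* Let $\mathcal{K}\subset E$ be a closed convex cone, let $c\in E$ be nonzero and such that there exists $x\in\mathcal{K}$ with $\langle c,x\rangle>0$, and let $\rho:E\to\mathbb{R}$ be a convex quartic form with $\alpha^2\|x\|^4\le\rho(x)\le\beta^2\|x\|^4$ for all $x\in E$, where $0<\alpha\le\beta$; put $\kappa=\beta/\alpha$. Let $f(x)=\rho(x)-\langle c,x\rangle$, let $x^*$ be a minimizer of $f$ over $\mathcal{K}$, and let $y^*$ be the solution of the homogenized problem of minimizing $\sqrt{\rho(y)}$ over $\{y\in\mathcal{K}:\langle c,y\rangle=1\}$. Then the homogenized gradient method (described in the context), initialized at $y_0\in E$, finds a point $x_K$ satisfying $$\frac{f(x_K)-f(x^* )}{|f(x^* )|}\le\delta$$ in at most $$\mathcal{O}\left(\kappa\left(\log\Big(\frac{\delta_0}{\delta}\Big)+\sqrt{\frac1\delta}\right)\right)$$ iterations, where the initial relative accuracy is $\delta_0=\sqrt{\frac{\rho(y_0)}{\rho(y^* )}}-1$.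
   Context: $E$ is a Euclidean space with canonical inner product $\langle\cdot,\cdot\rangle$, and $\|\cdot\|$ is a Euclidean norm $\|x\|=\langle Bx,x\rangle^{1/2}$ induced by a self-adjoint positive definite operator $B$. A convex quartic form is a convex function $\rho$ of the form $\rho(x)=Q[x,x,x,x]$, where $Q:E^4\to\mathbb{R}$ is $4$-linear and symmetric (invariant under permutations of its arguments). The number $\kappa$ is called the quartic condition number of $\rho$. Homogenized gradient method with $K$ iterations: initialize $y_0\in E$; for $k=0,1,\dots,K-1$ compute $$y_{k+1}=\operatorname*{argmin}\left\{\frac{1}{2\sqrt{\rho(y_k)}}\langle\nabla\rho(y_k),y-y_k\rangle+3\beta\|y-y_k\|^2\ :\ y\in\mathcal{K},\ \langle c,y\rangle=1\right\};$$ return $x_K=y_K/(4\rho(y_K))^{1/3}$.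
   Formalization: For y_0 outside {y in K : <c,y>=1}, log(δ_0/δ) is read as max(0, log(δ_0/δ)) (0 if δ_0 ≤ 0), since the bound may otherwise be negative or undefined; for feasible y_0 it is verbatim, with log(δ_0/δ) read as 0 when δ_0 = 0. *)

(* Defs.v *)
From HB Require Import structures.
From mathcomp Require Import all_boot all_order all_algebra perm.
From mathcomp Require Import all_classical all_reals all_analysis.

Set Implicit Arguments.
Unset Strict Implicit.
Unset Printing Implicit Defensive.

Import Order.TTheory GRing.Theory Num.Theory.
Import numFieldNormedType.Exports.

Local Open Scope classical_set_scope.
Local Open Scope ring_scope.

(* The Euclidean space E is R^n, as row vectors (the library convention for
   differentials), with the dot product as canonical inner product. *)
Definition dotv (R : realType) (n : nat) (x y : 'rV[R]_n) : R :=
  \sum_(i < n) x 0 i * y 0 i.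

Definition self_adjoint (R : realType) (n : nat)
    (B : {linear 'rV[R]_n -> 'rV[R]_n}) : Prop :=
  forall x y : 'rV[R]_n, dotv (B x) y = dotv x (B y).

Definition positive_definite (R : realType) (n : nat)
    (B : {linear 'rV[R]_n -> 'rV[R]_n}) : Prop :=
  forall x : 'rV[R]_n, x != 0 -> 0 < dotv (B x) x.

Definition enorm (R : realType) (n : nat)
    (B : {linear 'rV[R]_n -> 'rV[R]_n}) (x : 'rV[R]_n) : R :=
  Num.sqrt (dotv (B x) x).

(* Gradient for the canonical inner product (not for the one induced by B):
   dotv (gradient f x) h = 'd f x h. *)
Definition gradient (R : realType) (n : nat) (f : 'rV[R]_n -> R)
    (x : 'rV[R]_n) : 'rV[R]_n :=
  \row_(i < n) ('d f x (delta_mx 0 i : 'rV[R]_n) : R).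

(* The arguments of a function E^4 -> R are given as a family indexed by 'I_4;
   dfwith v z is v with its i-th entry replaced by z. *)
Definition four_linear (R : realType) (n : nat)
    (Q : ('I_4 -> 'rV[R]_n) -> R) : Prop :=
  forall (v : 'I_4 -> 'rV[R]_n) (i : 'I_4) (a : R) (x y : 'rV[R]_n),
    let Qi z := Q (@dfwith 'I_4 (fun=> 'rV[R]_n) v i z) in
    Qi (a *: x + y) = a * Qi x + Qi y.

Definition symmetric_form (R : realType) (n : nat)
    (Q : ('I_4 -> 'rV[R]_n) -> R) : Prop :=
  forall (v : 'I_4 -> 'rV[R]_n) (s : 'S_4), Q (fun i => v (s i)) = Q v.

Definition convex_quartic_form (R : realType) (n : nat)
    (rho : 'rV[R]_n -> R) : Prop :=
  (exists Q : ('I_4 -> 'rV[R]_n) -> R,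
     [/\ four_linear Q, symmetric_form Q & forall x, rho x = Q (fun=> x)]) /\
  convex_function (E := 'rV[R]_n) setT rho.

Definition closed_convex_cone (R : realType) (n : nat)
    (K : set 'rV[R]_n) : Prop :=
  [/\ closed K, convex_set (M := 'rV[R]_n) K &
      forall (t : R) (x : 'rV[R]_n), 0 <= t -> K x -> K (t *: x)].

Definition is_argmin (R : realType) (T : Type) (A : set T) (g : T -> R)
    (x : T) : Prop :=
  A x /\ forall y, A y -> g x <= g y.

Definition objective (R : realType) (n : nat) (rho : 'rV[R]_n -> R)
    (c x : 'rV[R]_n) : R :=
  rho x - dotv c x.

Definition slice (R : realType) (n : nat) (K : set 'rV[R]_n)
    (c : 'rV[R]_n) : set 'rV[R]_n :=
  [set y | K y /\ dotv c y = 1].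

(* At z = 0 the coefficient is 0^-1 = 0, and the linear term vanishes: this is
   indeed the linearization at 0 of sqrt(rho), whose gradient there is 0. *)
Definition hgm_model (R : realType) (n : nat)
    (B : {linear 'rV[R]_n -> 'rV[R]_n}) (rho : 'rV[R]_n -> R) (beta : R)
    (z y : 'rV[R]_n) : R :=
  (2 * Num.sqrt (rho z))^-1 * dotv (gradient rho z) (y - z)
  + 3 * beta * enorm B (y - z) ^+ 2.

(* y 0, ..., y N are the iterates of the homogenized gradient method run for N
   iterations from y0 (the values of y beyond N are irrelevant). *)
Definition hgm_run (R : realType) (n : nat)
    (B : {linear 'rV[R]_n -> 'rV[R]_n}) (rho : 'rV[R]_n -> R) (beta : R)
    (K : set 'rV[R]_n) (c y0 : 'rV[R]_n) (N : nat) (y : nat -> 'rV[R]_n)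
    : Prop :=
  y 0%N = y0 /\
  forall k : nat, (k < N)%N ->
    is_argmin (slice K c) (hgm_model B rho beta (y k)) (y k.+1).

Definition hgm_output (R : realType) (n : nat) (rho : 'rV[R]_n -> R)
    (y : 'rV[R]_n) : 'rV[R]_n :=
  ((4 * rho y) `^ (3^-1))^-1 *: y.

Definition rel_accuracy (R : realType) (n : nat) (rho : 'rV[R]_n -> R)
    (c x xstar : 'rV[R]_n) : R :=
  (objective rho c x - objective rho c xstar) / `|objective rho c xstar|.

(* Main.v *)
(* sqrt(rho) is convex, and its Hessian is at most 6 sqrt(rho(h)) in the
   direction h, because convexity of rho yields Q[x,x,h,h] <= sqrt(rho(x) rho(h)).
   So the method is a projected gradient method on sqrt(rho), and the three-point
   inequality bounds the relative excess eps of sqrt(rho) after k steps by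
   6 kappa (2 + delta0) / k, i.e. by max(1, delta0) after 18 kappa steps; the
   factor 2 + delta0 accounts for infeasible starting points. Convexity of rho
   also gives rho(y) - rho(ystar) >= rho(y - ystar) / 8 on the slice, so that a
   step improves eps to eps' <= eps (1 - min(1, sqrt eps) / (60 kappa)). The
   potential ln eps - 2 / sqrt eps then drops by 1 / (60 kappa) per step, in the
   geometric phase eps >= 1 as in the sublinear phase eps <= 1. Finally the
   relative accuracy of the output is 1 - (1 + eps)^(-2/3) <= eps. *)

Require Import Defs.
From HB Require Import structures.
From mathcomp Require Import all_boot all_order all_algebra perm.
From mathcomp Require Import all_classical all_reals all_analysis.
From mathcomp Require Import ring lra.

Import Order.TTheory GRing.Theory Num.Theory.
Import numFieldNormedType.Exports.

Local Open Scope classical_set_scope.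
Local Open Scope ring_scope.

(** * Symmetric four-linear forms *)

Section quartic_form.
Context {R : realType} {n : nat}.
Local Notation V := 'rV[R]_n.
Implicit Types (Q : ('I_4 -> V) -> R) (rho : V -> R) (x y z w h : V).

Definition eval4 Q x y z w : R := Q (tnth [tuple x; y; z; w]).

Lemma eval4_dfwith Q x y z w (i : 'I_4) u :
  Q (@dfwith 'I_4 (fun=> V) (tnth [tuple x; y; z; w]) i u) =
  eval4 Q (if i == 0 then u else x) (if i == 1 then u else y)
    (if i == 2 then u else z) (if i == 3 then u else w).
Proof.
congr Q; apply/funext => j; case: dfwithP => [|{}j ij];
  [|move: ij; case: j => -[|[|[|[|//]]]] ?];
  by case: i => -[|[|[|[|//]]]] ?; rewrite !(tnth_nth 0).
Qed.

Lemma eval4_linear Q : four_linear Q ->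
  [/\ forall a u v y z w,
        eval4 Q (a *: u + v) y z w = a * eval4 Q u y z w + eval4 Q v y z w,
      forall a u v x z w,
        eval4 Q x (a *: u + v) z w = a * eval4 Q x u z w + eval4 Q x v z w,
      forall a u v x y w,
        eval4 Q x y (a *: u + v) w = a * eval4 Q x y u w + eval4 Q x y v w &
      forall a u v x y z,
        eval4 Q x y z (a *: u + v) = a * eval4 Q x y z u + eval4 Q x y z v].
Proof.
move=> linQ; split=> a u v.
- move=> y z w; have := linQ (tnth [tuple 0; y; z; w]) 0 a u v.
  by rewrite /= !eval4_dfwith.
- move=> x z w; have := linQ (tnth [tuple x; 0; z; w]) 1 a u v.
  by rewrite /= !eval4_dfwith.
- move=> x y w; have := linQ (tnth [tuple x; y; 0; w]) 2 a u v.
  by rewrite /= !eval4_dfwith.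
- move=> x y z; have := linQ (tnth [tuple x; y; z; 0]) 3 a u v.
  by rewrite /= !eval4_dfwith.
Qed.

(** Adjacent transpositions generate all permutations, so these equations suffice to sort
    arguments. *)
Lemma eval4_perm Q : Defs.symmetric_form Q ->
  [/\ forall x y z w, eval4 Q x y z w = eval4 Q y x z w,
      forall x y z w, eval4 Q x y z w = eval4 Q x z y w &
      forall x y z w, eval4 Q x y z w = eval4 Q x y w z].
Proof.
move=> symQ; split=> x y z w.
- rewrite /eval4 -(symQ _ (tperm 0 1)); congr Q; apply/funext => i.
  by case: tpermP => [->|->|]//; case: i => -[|[|[|[|//]]]] ?;
    rewrite !(tnth_nth 0)//= => /eqP + /eqP.
- rewrite /eval4 -(symQ _ (tperm 1 2)); congr Q; apply/funext => i.
  by case: tpermP => [->|->|]//; case: i => -[|[|[|[|//]]]] ?;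
    rewrite !(tnth_nth 0)//= => /eqP + /eqP.
- rewrite /eval4 -(symQ _ (tperm 2 3)); congr Q; apply/funext => i.
  by case: tpermP => [->|->|]//; case: i => -[|[|[|[|//]]]] ?;
    rewrite !(tnth_nth 0)//= => /eqP + /eqP.
Qed.

Lemma eval4_diag Q x : Q (fun=> x) = eval4 Q x x x x.
Proof.
by congr Q; apply/funext => -[[|[|[|[|//]]]] ?]; rewrite !(tnth_nth 0).
Qed.

(** Serves twice: [u = s], [v = t] expands the form along lines, and the general case is one twelfth
    of its Hessian at [s x + t h] in direction [u x + v h]. *)
Lemma eval4_expand Q x h s t u v : four_linear Q -> Defs.symmetric_form Q ->
  eval4 Q (s *: x + t *: h) (s *: x + t *: h)
          (u *: x + v *: h) (u *: x + v *: h)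
  = eval4 Q x x x x * (s * u) ^+ 2
    + 2 * eval4 Q x x x h * (s * u) * (s * v + t * u)
    + eval4 Q x x h h * ((s * v + t * u) ^+ 2 + 2 * (t * v) * (s * u))
    + 2 * eval4 Q x h h h * (t * v) * (s * v + t * u)
    + eval4 Q h h h h * (t * v) ^+ 2.
Proof.
move=> /eval4_linear[l0 l1 l2 l3] /eval4_perm[p0 p1 p2].
have Z0 y z w : eval4 Q 0 y z w = 0.
  by have := l0 (-1) 0 0 y z w; rewrite scaler0 addr0 mulN1r addNr.
have Z1 y z w : eval4 Q y 0 z w = 0 by rewrite p0.
have Z2 y z w : eval4 Q y z 0 w = 0 by rewrite p1.
have Z3 y z w : eval4 Q y z w 0 = 0 by rewrite p2.
(* Appending [+ 0] gives the last summand, too, the shape [a *: u + v] that linearity rewrites. *)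
rewrite -[t *: h]addr0 -[v *: h]addr0 !(l0, l1, l2, l3, Z0, Z1, Z2, Z3).
rewrite (p2 x x h x) (p1 x h x x) (p2 x x h x) (p0 h x x x) (p1 x h x x).
rewrite (p2 x x h x) (p2 x h h x) (p1 x h x h) (p0 h x x h) (p1 x h x h).
rewrite (p2 h x h x) (p0 h x x h) (p1 x h x h) (p1 h h x x) (p0 h x h x).
rewrite (p2 x h h x) (p1 x h x h).
rewrite (p2 h h h x) (p1 h h x h) (p0 h x h h).
ring.
Qed.

End quartic_form.

(** * Differentiability and gradient of a quartic form *)

Section gradient.
Context {R : realType} {n : nat}.
Local Notation V := 'rV[R]_n.

Lemma linear_form_coord (F : V -> R) (x : V) :
  (forall a u v, F (a *: u + v) = a * F u + F v) ->
  F x = \sum_(i < n) x 0 i * F (delta_mx 0 i).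
Proof.
move=> linF; rewrite [in LHS](row_sum_delta x).
elim/big_rec2 : _ => [|i b v _ <-]; last by rewrite linF.
by have := linF (-1) 0 0; rewrite scaler0 addr0 mulN1r addNr.
Qed.

(** Expanding the first slot in coordinates makes [G y y] a finite sum of products, so that the
    slots of a multilinear form can be peeled off one at a time. *)
Lemma differentiable_linear_arg (G : V -> V -> R) (x : V) :
  (forall a u v y, G (a *: u + v) y = a * G u y + G v y) ->
  (forall u, differentiable (G u) x) ->
  differentiable (fun y => G y y) x.
Proof.
move=> linG dG.
rewrite (_ : (fun y => G y y) =
  \sum_(i < n) ((fun y : V => y 0 i) * G (delta_mx 0 i))).
  apply: differentiable_sum => i; apply: differentiableM; last exact: dG.
  exact: differentiable_coord.
apply/funext => y; rewrite (linear_form_coord (fun u => G u y)) ?fct_sumE//.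
Qed.

Lemma differentiable_eval4 (Q : ('I_4 -> V) -> R) (x : V) : four_linear Q ->
  differentiable (fun y => eval4 Q y y y y) x.
Proof.
move=> /eval4_linear[l0 l1 l2 l3].
apply: (@differentiable_linear_arg (fun u y => eval4 Q u y y y)) => // u0.
apply: (@differentiable_linear_arg (fun u y => eval4 Q u0 u y y)) => // u1.
apply: (@differentiable_linear_arg (fun u y => eval4 Q u0 u1 u y)) => // u2.
apply: (@differentiable_linear_arg (fun u y => eval4 Q u0 u1 u2 u)) => // u3.
Qed.

Lemma dotv_gradient (f : V -> R) (x h : V) :
  dotv (gradient f x) h = 'd f x h.
Proof.
rewrite (linear_form_coord ('d f x)); last by move=> a u v; rewrite linearP.
by rewrite /dotv; apply: eq_bigr => i _; rewrite mxE mulrC.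
Qed.

Lemma gradient_quartic (Q : ('I_4 -> V) -> R) (rho : V -> R) (x h : V) :
  four_linear Q -> Defs.symmetric_form Q -> (forall y, rho y = Q (fun=> y)) ->
  dotv (gradient rho x) h = 4 * eval4 Q x x x h.
Proof.
move=> linQ symQ rhoQ; have -> : rho = fun y => eval4 Q y y y y.
  by apply/funext => y; rewrite rhoQ eval4_diag.
rewrite dotv_gradient -deriveE; last exact: differentiable_eval4.
rewrite /derive; apply/cvg_lim => //.
(* [p] is the difference quotient along [h], extended continuously to [t = 0]. *)
pose p : {poly R} := (4 * eval4 Q x x x h)%:P
  + (6 * eval4 Q x x h h)%:P * 'X + (4 * eval4 Q x h h h)%:P * 'X^2
  + (eval4 Q h h h h)%:P * 'X^3.
apply: (@cvg_trans _ (horner p @ 0^')).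
  apply: near_eq_cvg; near=> t.
  have t0 : t != 0 by near: t; exact: nbhs_dnbhs_neq.
  rewrite /p !hornerE/= -[in RHS](scale1r x) [t *: h + _]addrC.
  rewrite -(scale1r x) eval4_expand// scale1r.
  rewrite scale1r /GRing.scale/=; field; exact: t0.
have <- : p.[0] = 4 * eval4 Q x x x h.
  by rewrite /p !hornerE/= ?expr0n/= ?mulr0 ?addr0.
apply: cvg_within_filter; exact: continuous_horner.
Unshelve. all: by end_near. Qed.

End gradient.

(** * Convex quartic forms on lines and planes *)

Section convex_quartic.
Context {R : realType} {n : nat}.
Local Notation V := 'rV[R]_n.

Lemma half_i01 : exists p : {i01 R}, p%:inum = 2^-1 :> R.
Proof.
have h1 : 0 <= (2^-1 : R) by lra.
have h2 : (2^-1 : R) <= 1 by lra.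
by exists (Itv01 h1 h2).
Qed.

Lemma convex_function_midpoint (rho : V -> R) (x h : V) :
  convex_function (E := V) setT rho -> 2 * rho x <= rho (x + h) + rho (x - h).
Proof.
move=> cvx; have [p pE] := half_i01.
have := cvx p (x + h) (x - h) (in_setT _) (in_setT _).
rewrite convRE/= /conv/= pE /unstable.onem.
have -> : (1 - 2^-1 : R) = 2^-1 by lra.
rewrite -scalerDr addrACA subrr addr0 -mulr2n -(scaler_nat 2 x) scalerA mulVf//.
by rewrite scale1r; lra.
Qed.

Lemma convex_set_segment (K : set V) (x y : V) (t : R) :
  convex_set (M := V) K -> K x -> K y -> 0 <= t -> t <= 1 ->
  K (x + t *: (y - x)).
Proof.
move=> cvxK Kx Ky t0 t1.
have := cvxK y x (Itv01 t0 t1) (mem_set Ky) (mem_set Kx).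
rewrite inE /conv/= /unstable.onem scalerBl scale1r scalerBr addrCA.
exact.
Qed.

(** The limit at 0 in elementary form: if [D < 0], then [t = - D / (2 (M - D))] makes the expression
    negative. *)
Lemma ge0_of_small (D M : R) :
  (forall t, 0 < t -> t <= 1 -> 0 <= D + t * M) -> 0 <= D.
Proof.
move=> h; rewrite leNgt; apply/negP => D0.
have M0 : 0 < M.
  by have := h 1 ltr01 (lexx _); lra.
have t0 : 0 < - D / (M - D) / 2 by rewrite !divr_gt0//; lra.
have t1 : - D / (M - D) / 2 <= 1.
  by rewrite ler_pdivrMr// ler_pdivrMr; nra.
have := h _ t0 t1.
suff : - D / (M - D) / 2 * M < - D by lra.
by rewrite -mulrA mulrAC ltr_pdivrMr; nra.
Qed.

(** Convexity of [rho] enters the later arguments only here. The numbers [b], [c], [d] are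
    Q[x,x,x,h], Q[x,x,h,h], Q[x,h,h,h]; the last clause says that the Hessian is nonnegative on the
    plane of [x] and [h]. *)
Lemma convex_quartic_plane (rho : V -> R) (x h : V) :
  convex_quartic_form rho ->
  exists b c d : R,
  [/\ dotv (gradient rho x) h = 4 * b,
      forall t, rho (x + t *: h) = rho x + 4 * b * t + 6 * c * t ^+ 2
        + 4 * d * t ^+ 3 + rho h * t ^+ 4 &
      forall s t u v, 0 <= rho x * (s * u) ^+ 2
        + 2 * b * (s * u) * (s * v + t * u)
        + c * ((s * v + t * u) ^+ 2 + 2 * (t * v) * (s * u))
        + 2 * d * (t * v) * (s * v + t * u) + rho h * (t * v) ^+ 2].
Proof.
move=> [[Q [linQ symQ rhoQ]] cvx].
have rhoE y : rho y = eval4 Q y y y y by rewrite rhoQ eval4_diag.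
exists (eval4 Q x x x h), (eval4 Q x x h h), (eval4 Q x h h h).
have lineE y w t : rho (y + t *: w) = rho y + 4 * eval4 Q y y y w * t
    + 6 * eval4 Q y y w w * t ^+ 2 + 4 * eval4 Q y w w w * t ^+ 3
    + rho w * t ^+ 4.
  by rewrite !rhoE -[X in X + t *: w]scale1r eval4_expand//; ring.
split=> [||s t u v]; [exact: gradient_quartic|exact: lineE|].
rewrite !rhoE -eval4_expand//.
set z := s *: x + t *: h; set w := u *: x + v *: h.
suff : 0 <= 6 * eval4 Q z z w w by lra.
apply: (@ge0_of_small _ (rho w)) => t0 t0_gt0 t0_le1.
suff : 0 <= t0 * (6 * eval4 Q z z w w + t0 * rho w) by rewrite pmulr_rge0.
(* Odd powers cancel in the second difference of [rho] at [z] along [r *: w], which is twice the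
   goal expression. *)
pose r := Num.sqrt t0.
have r2 : r ^+ 2 = t0 by rewrite sqr_sqrtr// ltW.
have := @convex_function_midpoint rho z (r *: w) cvx.
rewrite -scaleNr !lineE -r2; lra.
Qed.

End convex_quartic.

(** * Convex binary quartics *)

Section binary_quartic.
Context {R : realType} (a b c d e : R).
(** One twelfth of the Hessian of [a s^4 + 4 b s^3 t + 6 c s^2 t^2 + 4 d s t^3 + e t^4] at [(s, t)]
    in direction [(u, v)]. *)
Hypothesis hess_ge0 : forall s t u v : R,
  0 <= a * (s * u) ^+ 2 + 2 * b * (s * u) * (s * v + t * u)
     + c * ((s * v + t * u) ^+ 2 + 2 * (t * v) * (s * u))
     + 2 * d * (t * v) * (s * v + t * u) + e * (t * v) ^+ 2.

(** At [t = v = 1] the Hessian depends only on [m = s + u] and [q = s u]; real [s], [u] exist when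
    [m^2 - 4 q >= 0]. *)
Lemma hess_ge0_sum_prod (m q : R) : 4 * q <= m ^+ 2 ->
  0 <= a * q ^+ 2 + 2 * b * q * m + c * (m ^+ 2 + 2 * q) + 2 * d * m + e.
Proof.
move=> qm; pose r := Num.sqrt (m ^+ 2 - 4 * q).
have r2 : r ^+ 2 = m ^+ 2 - 4 * q by rewrite sqr_sqrtr// subr_ge0.
have := hess_ge0 ((m + r) / 2) 1 ((m - r) / 2) 1.
have -> : (m + r) / 2 * ((m - r) / 2) = q.
  have -> : (m + r) / 2 * ((m - r) / 2) = (m ^+ 2 - r ^+ 2) / 4 by field.
  by rewrite r2; field.
have -> : (m + r) / 2 * 1 + 1 * ((m - r) / 2) = m by field.
by rewrite !mulr1 expr1n !mulr1.
Qed.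

Lemma mid_coef_ge0 : 0 <= c.
Proof. by have := hess_ge0 1 0 0 1; lra. Qed.

(** At [(1, 0)] in direction [(- b, a)] the Hessian form is [a (a c - b^2)]. *)
Lemma sqr_snd_coef_le : 0 < a -> b ^+ 2 <= a * c.
Proof.
move=> a0; have h := hess_ge0 1 0 (- b) a.
by rewrite -subr_ge0 -(pmulr_rge0 _ a0); lra.
Qed.

(** The point [(sqrt E, sqrt A)] and direction [(sqrt E, - sqrt A)] cancel the terms in [b] and [d],
    leaving [2 A E (A E - c)]. *)
Lemma mid_coef_le (A E : R) : a = A ^+ 2 -> e = E ^+ 2 -> 0 < A -> 0 < E ->
  c <= A * E.
Proof.
move=> aA eE A0 E0.
have := hess_ge0 (Num.sqrt E) (Num.sqrt A) (Num.sqrt E) (- Num.sqrt A).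
have sA : Num.sqrt A * Num.sqrt A = A by rewrite -expr2 sqr_sqrtr ?ltW.
have sE : Num.sqrt E * Num.sqrt E = E by rewrite -expr2 sqr_sqrtr ?ltW.
rewrite !mulrN sA sE [Num.sqrt E * _]mulrC addNr aA eE => h.
have AE0 : 0 < 2 * (A * E) by rewrite !mulr_gt0.
by rewrite -subr_ge0 -(pmulr_rge0 _ AE0); lra.
Qed.

(* The weighted sum of the inequalities [c <= A E] and [hess_ge0_sum_prod] at
   [m = - 2 E / A], [q = - E / A] leaves the square [4 (b / A + E) ^+ 2]. *)
Lemma sqrt_quartic_smooth (A E F : R) : a = A ^+ 2 -> e = E ^+ 2 ->
  F ^+ 2 = a + 4 * b + 6 * c + 4 * d + e -> 0 < A -> 0 < E ->
  F <= A + 2 * b / A + 3 * E.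
Proof.
move=> aA eE FE A0 E0.
have cAE := mid_coef_le A E aA eE A0 E0.
have a0 : 0 < a by rewrite aA exprn_gt0.
pose B := b / A; pose k := E / A.
have bB : b = B * A by rewrite /B divfK// gt_eqF.
have EkA : E = k * A by rewrite /k divfK// gt_eqF.
have k0 : 0 < k by rewrite divr_gt0.
have B2 : B ^+ 2 <= c.
  have := sqr_snd_coef_le a0; rewrite bB aA exprMn mulrC.
  by rewrite ler_pM2l// exprn_gt0.
rewrite -mulrA -/B.
(* This sign permits squaring; it follows from [B^2 <= c <= A E], hence [2 |B| <= A + E]. *)
have rhs0 : 0 <= A + 2 * B + 3 * E.
  have : `|2 * B| <= A + E.
    rewrite -(@ler_pXn2r _ 2) ?nnegrE ?normr_ge0//; last lra.
    rewrite real_normK ?num_real//.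
    have := sqr_ge0 (A - E); nra.
  by rewrite ler_norml => /andP[]; lra.
have [F0|F0] := leP F 0; first exact: le_trans F0 rhs0.
rewrite -(@ler_pXn2r _ 2) ?nnegrE ?(ltW F0)//.
have := hess_ge0_sum_prod (- 2 * k) (- k).
have -> : 4 * - k <= (- 2 * k) ^+ 2 by have := sqr_ge0 k; lra.
move=> /(_ isT) h.
have : 0 <= k^-1 * (a * (- k) ^+ 2 + 2 * b * - k * (- 2 * k)
    + c * ((- 2 * k) ^+ 2 + 2 * - k) + 2 * d * (- 2 * k) + e).
  by rewrite mulr_ge0// invr_ge0 ltW.
have -> : k^-1 * (a * (- k) ^+ 2 + 2 * b * - k * (- 2 * k)
    + c * ((- 2 * k) ^+ 2 + 2 * - k) + 2 * d * (- 2 * k) + e)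
    = 2 * A * E + 4 * B * E + c * (4 * k - 2) - 4 * d.
  by rewrite eE EkA bB aA; field; rewrite gt_eqF.
have : 0 <= (1 + k) * (A * E - c) by rewrite mulr_ge0 ?subr_ge0//; lra.
have -> : (1 + k) * (A * E - c) = A * E + E ^+ 2 - c - k * c.
  by rewrite [in RHS]expr2 [in X in _ + X * _ - _ - _]EkA; ring.
have := sqr_ge0 (B + E).
rewrite FE aA eE bB; lra.
Qed.

(** With [B = b / A] and [k = B / A], [F^2 - (A + 2 B)^2] is the form of [hess_ge0_sum_prod] at
    [m = 2], [q = - 2 k], plus [2 c (1 + 2 k)]. If [A + 2 B > 0], then [1 + 2 k > 0], which makes
    both terms nonnegative. *)
Lemma sqrt_quartic_convex (A F : R) : a = A ^+ 2 ->
  F ^+ 2 = a + 4 * b + 6 * c + 4 * d + e -> 0 < A -> 0 <= F ->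
  A + 2 * b / A <= F.
Proof.
move=> aA FE A0 F0; rewrite -mulrA.
have c0 := mid_coef_ge0.
pose B := b / A; rewrite -/B.
have bB : b = B * A by rewrite /B divfK// gt_eqF.
have [l0|l0] := leP (A + 2 * B) 0; first exact: le_trans l0 F0.
rewrite -(@ler_pXn2r _ 2) ?nnegrE ?(ltW l0)//.
pose k := B / A.
have BkA : B = k * A by rewrite /k divfK// gt_eqF.
have k1 : 0 < 1 + 2 * k.
  by rewrite -(pmulr_rgt0 _ A0); move: l0; rewrite BkA; lra.
have := hess_ge0_sum_prod 2 (- 2 * k).
have -> : 4 * (- 2 * k) <= 2 ^+ 2 by lra.
move=> /(_ isT).
have : 0 <= c * (1 + 2 * k) by rewrite mulr_ge0// ltW.
rewrite FE bB aA BkA; lra.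
Qed.

End binary_quartic.

(** * Iteration count *)

Section potential.
Context {R : realType}.
Implicit Types (x kappa mu delta : R).

(** The derivative [1 / x + x^(-3/2)] is at least [1 / (x min(1, sqrt x))], which offsets the
    slowdown for small [x]. *)
Definition potential x : R := ln x - 2 / Num.sqrt x.

(** The logarithm loses at least [mu]; since [(1 - mu) (1 + mu / 2)^2 <= 1], the inverse square root
    grows by a factor of at least [1 + mu / 2]. *)
Lemma potential_contraction x x' mu : 0 < x -> 0 < x' -> 0 < mu < 1 ->
  x' <= x * (1 - mu) ->
  potential x' <= potential x - mu - mu / Num.sqrt x.
Proof.
move=> x0 x'0 /andP[mu0 mu1] xx'; rewrite /potential.
have lnx' : ln x' <= ln x - mu.
  apply: (@le_trans _ _ (ln (x * (1 - mu)))).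
    by rewrite ler_ln// posrE ?mulr_gt0// subr_gt0.
  rewrite lnM ?posrE ?subr_gt0// lerD2l.
  by apply: le_ln1Dx; rewrite ltrN2.
pose s := Num.sqrt x; pose s' := Num.sqrt x'.
have s0 : 0 < s by rewrite sqrtr_gt0.
have s'0 : 0 < s' by rewrite sqrtr_gt0.
have ss' : s' * (1 + mu / 2) <= s.
  rewrite -(@ler_pXn2r _ 2) ?nnegrE ?(ltW s0)//; last first.
    by rewrite mulr_ge0 ?(ltW s'0)//; lra.
  rewrite exprMn /s /s' !sqr_sqrtr ?(ltW x0) ?(ltW x'0)//.
  have : x' * (1 + mu / 2) ^+ 2 <= x * (1 - mu) * (1 + mu / 2) ^+ 2.
    by rewrite ler_wpM2r// sqr_ge0.
  move=> /le_trans; apply; rewrite -mulrA ger_pMr//.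
  have : 0 <= mu ^+ 2 by rewrite sqr_ge0.
  have : 0 <= mu ^+ 3 by rewrite exprn_ge0// ltW.
  lra.
have : (1 + mu / 2) / s <= s'^-1.
  by rewrite ler_pdivrMr// ler_pdivlMl.
rewrite -/s -/s'; rewrite mulrDl mul1r; move: lnx'; lra.
Qed.

(** The bound is least at [t = min(1, sqrt x) / (30 kappa)], with relative gain
    [mu = min(1, sqrt x) / (60 kappa)]. The drop comes from [mu] if [1 <= x], from [mu / sqrt x]
    otherwise. *)
Lemma potential_step kappa x x' : 1 <= kappa -> 0 < x -> 0 < x' ->
  (forall t, 0 <= t -> t <= 1 ->
     x' <= (1 - t) * x + t ^+ 2 * (15 * kappa * Num.max x (Num.sqrt x))) ->
  potential x' <= potential x - (60 * kappa)^-1.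
Proof.
move=> k1 x0 x'0 H.
have k0 : 0 < kappa by lra.
pose s := Num.sqrt x.
have s0 : 0 < s by rewrite sqrtr_gt0.
have xs : x = s ^+ 2 by rewrite sqr_sqrtr// ltW.
have kV0 : 0 < kappa^-1 by rewrite invr_gt0.
have kV1 : kappa^-1 <= 1 by rewrite invf_le1.
have k60 : (60 * kappa)^-1 = kappa^-1 / 60 by rewrite invfM mulrC.
have sV0 : 0 < s^-1 by rewrite invr_gt0.
have [x1|x1] := leP 1 x.
  have s1 : 1 <= s by rewrite -(@ler_pXn2r _ 2) ?nnegrE ?(ltW s0)// -xs expr1n.
  have mx : Num.max x s = x by apply/max_idPl; rewrite xs expr2 ler_peMr// ltW.
  have := @potential_contraction x x' (kappa^-1 / 60) x0 x'0.
  have -> : 0 < kappa^-1 / 60 < 1 by apply/andP; split; lra.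
  have : 0 < kappa^-1 / 60 / s by rewrite divr_gt0// divr_gt0.
  rewrite k60 => p0 /(_ isT) h.
  apply: le_trans (h _) _; last by rewrite -/s; lra.
  have := H (kappa^-1 / 30); rewrite -/s mx.
  have -> : (kappa^-1 / 30) ^+ 2 * (15 * kappa * x) = kappa^-1 / 60 * x.
    by field; rewrite gt_eqF.
  move=> /(_ ltac:(lra) ltac:(lra)); lra.
have s1 : s < 1 by rewrite -(@ltr_pXn2r _ 2) ?nnegrE ?(ltW s0)// -xs expr1n.
have mx : Num.max x s = s by apply/max_idPr; rewrite xs expr2 ler_piMr// ltW.
have sk0 : 0 < s * kappa^-1 by rewrite mulr_gt0.
have sk1 : s * kappa^-1 < 1.
  by apply: le_lt_trans s1; rewrite ler_piMr// ltW.
have := @potential_contraction x x' (s * kappa^-1 / 60) x0 x'0.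
have -> : 0 < s * kappa^-1 / 60 < 1 by apply/andP; split; lra.
have -> : s * kappa^-1 / 60 / Num.sqrt x = kappa^-1 / 60.
  by rewrite -/s; field; rewrite !gt_eqF.
rewrite k60 => /(_ isT) h; apply: le_trans (h _) _; last by lra.
have := H (s * kappa^-1 / 30); rewrite -/s mx.
have -> : (s * kappa^-1 / 30) ^+ 2 * (15 * kappa * s) = x * (s * kappa^-1 / 60).
  by rewrite xs; field; rewrite gt_eqF.
move=> /(_ ltac:(lra) ltac:(lra)); lra.
Qed.

Lemma potential_iter kappa (x : nat -> R) (k m : nat) : 1 <= kappa ->
  (forall j, (j <= m)%N -> 0 < x (k + j)%N) ->
  (forall j t, (j < m)%N -> 0 <= t -> t <= 1 ->
     x (k + j).+1 <= (1 - t) * x (k + j)%N + t ^+ 2 *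
       (15 * kappa * Num.max (x (k + j)%N) (Num.sqrt (x (k + j)%N)))) ->
  potential (x (k + m)%N) <= potential (x k) - m%:R * (60 * kappa)^-1.
Proof.
move=> k1; elim: m => [|m ih] x0 H; first by rewrite addn0 mul0r subr0.
have := ih (fun j jm => x0 j (leqW jm)) (fun j t jm => H j t (ltnW jm)).
have := potential_step kappa (x (k + m)%N) (x (k + m.+1)%N) k1
  (x0 _ (leqnSn _)) (x0 _ (leqnn _)).
have st t := H m t (leqnn _); rewrite -addnS in st; move=> /(_ st).
rewrite -[m.+1]addn1 natrD mulrDl mul1r; lra.
Qed.

(** The hypotheses start at index 1 because the initial point may be infeasible. *)
Lemma iteration_count kappa delta delta0 (x : nat -> R) (N : nat) :
  1 <= kappa -> 0 < delta -> delta < 1 ->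
  (forall k, (0 < k)%N -> (k < N)%N -> x k.+1 <= x k) ->
  (forall k, (0 < k)%N -> (k <= N)%N ->
     k%:R * x k <= 6 * kappa * (2 + delta0)) ->
  (forall k t, (0 < k)%N -> (k < N)%N -> 0 <= x k -> 0 <= t -> t <= 1 ->
     x k.+1 <= (1 - t) * x k +
       t ^+ 2 * (15 * kappa * Num.max (x k) (Num.sqrt (x k)))) ->
  300 * (kappa * (Num.max 0 (ln (delta0 / delta)) + Num.sqrt (1 / delta)))
    <= N%:R ->
  x N <= delta.
Proof.
move=> k1 d0 d1 xmono xsub xstep NC.
have k0 : 0 < kappa by lra.
pose S := Num.sqrt (1 / delta).
have SE : (Num.sqrt delta)^-1 = S by rewrite /S div1r sqrtrV// ltW.
have S1 : 1 <= S.
  by rewrite -sqrtr1 ler_wsqrtr// ler_pdivlMr// mul1r ltW.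
pose L := Num.max 0 (ln (delta0 / delta)).
have L0 : 0 <= L by rewrite le_max lexx.
rewrite -/S -/L in NC.
have kS : kappa <= kappa * S by rewrite ler_peMr// ltW.
have kL : 0 <= kappa * L by rewrite mulr_ge0// ltW.
pose K := (Num.truncn (18 * kappa)).+1.
have [Kl Ku] : 18 * kappa <= K%:R /\ K%:R <= 18 * kappa + 1.
  have /truncn_itv/andP[h1 h2] : 0 <= 18 * kappa by lra.
  by split; [exact: ltW|rewrite /K -natr1 lerD2r].
have KN : (K <= N)%N by rewrite -(ler_nat R); lra.
rewrite leNgt; apply/negP => dN.
(* Under the assumption [delta < x N], monotonicity keeps all values from index 1 on above [delta],
   hence in the domain of the potential. *)
have xpos i j : (0 < j)%N -> (i + j)%N = N -> delta < x j.
  elim: i j => [|i ih] j j0 ijN; first by rewrite -[j]add0n ijN.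
  have jN : (j < N)%N by rewrite -ijN addSn ltnS leq_addl.
  by apply: lt_le_trans (ih j.+1 isT _) (xmono j j0 jN); rewrite addnS -addSn.
have {}xpos j : (0 < j)%N -> (j <= N)%N -> delta < x j.
  by move=> j0 jN; apply: (xpos (N - j)%N) => //; rewrite subnK.
have [m NE] : exists m, N = (K + m)%N by exists (N - K)%N; rewrite subnKC.
(* Since [18 kappa <= K], the sublinear bound gives [3 x_K <= 2 + delta0], impossible if [x_K]
   exceeds both 1 and [delta0]. *)
have xK : x K <= Num.max 1 delta0.
  rewrite leNgt; apply/negP => h.
  have : 1 < x K by apply: le_lt_trans h; rewrite le_max lexx.
  have : delta0 < x K by apply: le_lt_trans h; rewrite le_max lexx orbT.
  move=> h1 h2; have := xsub K isT KN.
  have : 18 * kappa * x K <= K%:R * x K by rewrite ler_pM2r//; lra.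
  have : 0 < kappa * (3 * x K - 2 - delta0) by rewrite mulr_gt0//; lra.
  lra.
have Kj0 j : (0 < K + j)%N by rewrite addSn.
have KjN j : (j <= m)%N -> (K + j <= N)%N by rewrite NE leq_add2l.
have : potential (x (K + m)%N) <= potential (x K) - m%:R * (60 * kappa)^-1.
  apply: potential_iter => // [j jm|j t jm t0 t1].
    by apply: lt_trans d0 (xpos _ (Kj0 _) (KjN _ jm)).
  apply: xstep => //; first by rewrite NE ltn_add2l.
  by apply/ltW/(lt_trans d0)/(xpos _ (Kj0 _))/KjN/ltnW.
rewrite -NE /potential.
have : 0 < 2 / Num.sqrt (x K).
  by rewrite divr_gt0// sqrtr_gt0 (lt_trans d0)// xpos.
have : 2 / Num.sqrt (x N) <= 2 * S.
  rewrite -SE ler_pM2l// lef_pV2 ?posrE ?sqrtr_gt0 ?(lt_trans d0 dN)//.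
  by rewrite ler_wsqrtr// ltW.
have : ln delta <= ln (x N) by rewrite ler_ln ?posrE ?(lt_trans d0 dN)// ltW.
(* If [delta0 < 1], then [ln (x K) <= 0], and [- ln delta = 2 ln S <= 2 (S - 1)] suffices. *)
have : ln (x K) <= L + 2 * S + ln delta.
  have lS : - ln delta <= 2 * S.
    rewrite -lnV ?posrE// -div1r.
    have -> : 1 / delta = S ^+ 2 by rewrite sqr_sqrtr// divr_ge0// ltW.
    rewrite lnXn ?mulr_natl; last lra.
    have : ln (1 + (S - 1)) <= S - 1 by apply: le_ln1Dx; lra.
    have -> : 1 + (S - 1) = S by ring.
    rewrite mulr2n; lra.
  have xK0 : 0 < x K by rewrite (lt_trans d0)// xpos.
  have [D1|D1] := leP 1 delta0.
    have : ln (x K) <= ln delta0.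
      rewrite ler_ln ?posrE//; last lra.
      by apply: le_trans xK _; rewrite ge_max D1 lexx.
    have : ln (delta0 / delta) <= L by rewrite le_max lexx orbT.
    rewrite ln_div ?posrE//; lra.
  have : ln (x K) <= 0.
    by apply: ln_le0; apply: le_trans xK _; rewrite ge_max lexx ltW.
  lra.
move=> h1 h2 h3 h4 h5.
(* Hence [N <= 18 kappa + 1 + 60 kappa (L + 4 S)], at most [60 kappa L + 259 kappa S] as
   [1 <= kappa <= kappa S]; this is below [300 kappa (L + S)]. *)
have : m%:R * (60 * kappa)^-1 <= L + 4 * S by lra.
rewrite ler_pdivrMr; last lra.
have : N%:R = K%:R + m%:R :> R by rewrite NE natrD.
lra.
Qed.

End potential.

(** * The homogenized gradient method *)

Section dotv.
Context {R : realType} {n : nat}.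
Local Notation V := 'rV[R]_n.
Implicit Types (x y z h : V) (a : R).

Lemma dotvC x y : dotv x y = dotv y x.
Proof. by apply: eq_bigr => i _; rewrite mulrC. Qed.

Lemma dotvDr x y z : dotv x (y + z) = dotv x y + dotv x z.
Proof.
by rewrite /dotv -big_split; apply: eq_bigr => i _; rewrite mxE mulrDr.
Qed.

Lemma dotvZr a x y : dotv x (a *: y) = a * dotv x y.
Proof.
by rewrite /dotv mulr_sumr; apply: eq_bigr => i _; rewrite mxE mulrCA.
Qed.

Lemma dotv0r x : dotv x 0 = 0.
Proof. by rewrite -(scale0r 0) dotvZr mul0r. Qed.

Lemma dotvBr x y z : dotv x (y - z) = dotv x y - dotv x z.
Proof. by rewrite dotvDr -scaleN1r dotvZr mulN1r. Qed.

Lemma slice_segment (K : set V) (c : V) x y t :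
  closed_convex_cone K -> slice K c x -> slice K c y -> 0 <= t -> t <= 1 ->
  slice K c (x + t *: (y - x)).
Proof.
move=> [_ cvxK _] [Kx cx] [Ky cy] t0 t1; split; first exact: convex_set_segment.
by rewrite dotvDr dotvZr dotvBr cx cy subrr mulr0 addr0.
Qed.

Variable B : {linear V -> V}.
Hypotheses (saB : self_adjoint B) (pdB : positive_definite B).

Lemma enorm_arg_ge0 x : 0 <= dotv (B x) x.
Proof.
have [->|x0] := eqVneq x 0; first by rewrite dotv0r.
exact/ltW/pdB.
Qed.

Lemma sqr_enorm x : enorm B x ^+ 2 = dotv (B x) x.
Proof. by rewrite sqr_sqrtr// enorm_arg_ge0. Qed.

Lemma sqr_enormD x y :
  enorm B (x + y) ^+ 2 = enorm B x ^+ 2 + 2 * dotv (B x) y + enorm B y ^+ 2.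
Proof.
have BC : dotv (B y) x = dotv (B x) y by rewrite saB dotvC.
rewrite !sqr_enorm linearD dotvDr !(dotvC (_ + _)) !dotvDr !(dotvC _ (B _)) BC.
ring.
Qed.

Lemma sqr_enormZ a x : enorm B (a *: x) ^+ 2 = a ^+ 2 * enorm B x ^+ 2.
Proof. by rewrite !sqr_enorm linearZ dotvZr dotvC dotvZr dotvC mulrA. Qed.

Lemma sqr_enormB_le x y :
  enorm B (x - y) ^+ 2 <= 2 * enorm B x ^+ 2 + 2 * enorm B y ^+ 2.
Proof.
have := sqr_ge0 (enorm B (x + y)).
rewrite -scaleN1r !sqr_enormD sqr_enormZ dotvZr; lra.
Qed.

End dotv.


(** * Smoothness and convexity of the square root of [rho] *)

Section homogenized_gradient_method.
Context {R : realType} {n : nat}.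
Local Notation V := 'rV[R]_n.
Variables (B : {linear V -> V}) (rho : V -> R) (alpha beta : R).
Hypotheses (saB : self_adjoint B) (pdB : positive_definite B).
Hypotheses (rho_quartic : convex_quartic_form rho).
Hypotheses (alpha_gt0 : 0 < alpha) (beta_gt0 : 0 < beta).
Hypothesis rho_bounds : forall x, alpha ^+ 2 * enorm B x ^+ 4 <= rho x
                                  <= beta ^+ 2 * enorm B x ^+ 4.
Implicit Types (x y z h : V).

Lemma enorm_gt0 x : x != 0 -> 0 < enorm B x.
Proof. by move=> x0; rewrite sqrtr_gt0 pdB. Qed.

Lemma rho_gt0 x : x != 0 -> 0 < rho x.
Proof.
move=> x0; case/andP: (rho_bounds x) => + _; apply: lt_le_trans.
by rewrite mulr_gt0// exprn_gt0// enorm_gt0.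
Qed.

Lemma rho0 : rho 0 = 0.
Proof.
have e0 : enorm B 0 ^+ 4 = 0 by rewrite /enorm dotv0r sqrtr0 expr0n.
by apply/eqP; have := rho_bounds 0; rewrite e0 !mulr0 eq_le andbC.
Qed.

Lemma rho_ge0 x : 0 <= rho x.
Proof.
have [->|/rho_gt0/ltW//] := eqVneq x 0; by rewrite rho0.
Qed.

Lemma sqrt_rho_ge x : alpha * enorm B x ^+ 2 <= Num.sqrt (rho x).
Proof.
have l0 : 0 <= alpha * enorm B x ^+ 2 by rewrite mulr_ge0 ?sqr_ge0 ?ltW.
rewrite -(@ler_pXn2r _ 2) ?nnegrE ?sqrtr_ge0// (sqr_sqrtr (rho_ge0 x)).
by rewrite exprMn -exprM; case/andP: (rho_bounds x).
Qed.

Lemma sqrt_rho_le x : Num.sqrt (rho x) <= beta * enorm B x ^+ 2.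
Proof.
have l0 : 0 <= beta * enorm B x ^+ 2 by rewrite mulr_ge0 ?sqr_ge0 ?ltW.
rewrite -(@ler_pXn2r _ 2) ?nnegrE ?sqrtr_ge0// (sqr_sqrtr (rho_ge0 x)).
by rewrite exprMn -exprM; case/andP: (rho_bounds x).
Qed.

(** On the plane of [x] and [h], the gradient term is [2 b / A] with [A = sqrt (rho x)], and
    [E = sqrt (rho h)] is at most [beta |h|^2]. *)
Lemma sqrt_rho_smooth x h : Num.sqrt (rho (x + h)) <= Num.sqrt (rho x)
  + (2 * Num.sqrt (rho x))^-1 * dotv (gradient rho x) h
  + 3 * beta * enorm B h ^+ 2.
Proof.
have h0 : 0 <= enorm B h ^+ 2 by rewrite sqr_ge0.
have bh0 : 0 <= beta * enorm B h ^+ 2 by rewrite mulr_ge0 ?(ltW beta_gt0).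
have [->|x0] := eqVneq x 0.
  rewrite rho0 sqrtr0 mulr0 invr0 mul0r !add0r.
  have := sqrt_rho_le h; lra.
have [->|hn0] := eqVneq h 0.
  by rewrite dotv0r mulr0 !addr0 lerDl /enorm dotv0r sqrtr0 expr0n/= mulr0.
have [b [c [d [gE rhoE hess]]]] := convex_quartic_plane rho x h rho_quartic.
have A0 : 0 < Num.sqrt (rho x) by rewrite sqrtr_gt0 rho_gt0.
have E0 : 0 < Num.sqrt (rho h) by rewrite sqrtr_gt0 rho_gt0.
have := sqrt_quartic_smooth _ _ _ _ _ hess (Num.sqrt (rho x)) (Num.sqrt (rho h))
  (Num.sqrt (rho (x + h))).
rewrite !(sqr_sqrtr (rho_ge0 _)) => /(_ erefl erefl).
have -> : rho (x + h) = rho x + 4 * b + 6 * c + 4 * d + rho h.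
  by rewrite -[in LHS](scale1r h) rhoE !expr1n !mulr1.
move=> /(_ erefl A0 E0) /le_trans; apply.
rewrite gE.
have -> : (2 * Num.sqrt (rho x))^-1 * (4 * b) = 2 * b / Num.sqrt (rho x).
  by field; rewrite gt_eqF.
have := sqrt_rho_le h; lra.
Qed.

Lemma sqrt_rho_convex x h : Num.sqrt (rho x)
  + (2 * Num.sqrt (rho x))^-1 * dotv (gradient rho x) h
  <= Num.sqrt (rho (x + h)).
Proof.
have [->|x0] := eqVneq x 0.
  by rewrite rho0 sqrtr0 mulr0 invr0 mul0r !add0r sqrtr_ge0.
have [b [c [d [gE rhoE hess]]]] := convex_quartic_plane rho x h rho_quartic.
have A0 : 0 < Num.sqrt (rho x) by rewrite sqrtr_gt0 rho_gt0.
have := sqrt_quartic_convex _ _ _ _ _ hess (Num.sqrt (rho x))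
  (Num.sqrt (rho (x + h))).
rewrite !(sqr_sqrtr (rho_ge0 _)) => /(_ erefl).
have rE : rho (x + h) = rho x + 4 * b + 6 * c + 4 * d + rho h.
  by rewrite -[in LHS](scale1r h) rhoE !expr1n !mulr1.
move=> /(_ rE A0 (sqrtr_ge0 _)).
rewrite gE.
have -> // : (2 * Num.sqrt (rho x))^-1 * (4 * b) = 2 * b / Num.sqrt (rho x).
by field; rewrite gt_eqF.
Qed.

(** * Growth on the slice and one step of the method *)

Variables (K : set V) (c : V).
Hypothesis coneK : closed_convex_cone K.

Lemma slice_neq0 y : slice K c y -> y != 0.
Proof.
by move=> [_ cy]; apply: contra_eq_neq cy => ->; rewrite dotv0r eq_sym oner_eq0.
Qed.

(* The midpoint of [y] and [ystar] is feasible, and the even part of the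
   quartic [t |-> rho (mid + t (y - ystar) / 2)] gives the quartic growth. *)
Lemma quartic_growth ystar y :
  is_argmin (slice K c) (fun y => Num.sqrt (rho y)) ystar -> slice K c y ->
  rho ystar + rho (y - ystar) / 8 <= rho y.
Proof.
move=> [sstar minstar] sy.
pose m := ystar + 2^-1 *: (y - ystar).
have sm : slice K c m by apply: slice_segment => //; lra.
have rm : rho ystar <= rho m.
  by have := minstar m sm; rewrite ler_sqrt ?rho_ge0.
have [p [q [r [_ rhoE hess]]]] :=
  convex_quartic_plane rho m (y - ystar) rho_quartic.
have := rhoE (2^-1); have := rhoE (- 2^-1).
have -> : m + 2^-1 *: (y - ystar) = y.
  rewrite /m -addrA -scalerDl.
  have -> : 2^-1 + 2^-1 = 1 :> R by lra.
  by rewrite scale1r addrC subrK.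
have -> : m + (- 2^-1) *: (y - ystar) = ystar by rewrite scaleNr addrK.
(* The quartic terms at [t = 1/2] and [t = - 1/2] add up to [2 / 16] of [rho (y - ystar)], whence
   the factor 1/8. *)
have := mid_coef_ge0 _ _ _ _ _ hess; lra.
Qed.

Lemma hgm_model_upper z y :
  Num.sqrt (rho y) <= Num.sqrt (rho z) + hgm_model B rho beta z y.
Proof.
by have := sqrt_rho_smooth z (y - z); rewrite addrC subrK -addrA.
Qed.

Lemma hgm_model_lower z y :
  Num.sqrt (rho z) + hgm_model B rho beta z y
  <= Num.sqrt (rho y) + 3 * beta * enorm B (y - z) ^+ 2.
Proof.
have := sqrt_rho_convex z (y - z); rewrite [z + _]addrC subrK /hgm_model; lra.
Qed.

(** On the segment from [yplus] to [y] the model is quadratic with leading coefficient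
    [3 beta |y - yplus|^2]; minimality makes its slope [D] at [yplus] nonnegative. *)
Lemma hgm_model_three_points z yplus y :
  is_argmin (slice K c) (hgm_model B rho beta z) yplus -> slice K c y ->
  hgm_model B rho beta z yplus + 3 * beta * enorm B (y - yplus) ^+ 2
  <= hgm_model B rho beta z y.
Proof.
move=> [splus minplus] sy.
have modelE t : hgm_model B rho beta z (yplus + t *: (y - yplus)) =
    hgm_model B rho beta z yplus
    + t * ((2 * Num.sqrt (rho z))^-1 * dotv (gradient rho z) (y - yplus)
           + 6 * beta * dotv (B (yplus - z)) (y - yplus))
    + t ^+ 2 * (3 * beta * enorm B (y - yplus) ^+ 2).
  rewrite /hgm_model addrAC (dotvDr _ (yplus - z)) (dotvZr t).
  rewrite (sqr_enormD B saB pdB (yplus - z)) (sqr_enormZ B pdB t).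
  rewrite (dotvZr t); ring.
have -> : hgm_model B rho beta z y =
    hgm_model B rho beta z (yplus + 1 *: (y - yplus)).
  by rewrite scale1r (addrC yplus) subrK.
rewrite modelE mul1r expr1n mul1r.
set D := _ + 6 * beta * _; suff : 0 <= D by lra.
apply: (@ge0_of_small _ _ (3 * beta * enorm B (y - yplus) ^+ 2)) => t t0 t1.
rewrite -(pmulr_rge0 _ t0).
have := minplus _ (slice_segment K c yplus y t coneK splus sy (ltW t0) t1).
rewrite modelE -/D; lra.
Qed.

(** Here [z] may lie off the slice, which covers the first step from an infeasible start. *)
Lemma hgm_step_three_points z yplus y :
  is_argmin (slice K c) (hgm_model B rho beta z) yplus -> slice K c y ->
  Num.sqrt (rho yplus) + 3 * beta * enorm B (y - yplus) ^+ 2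
  <= Num.sqrt (rho y) + 3 * beta * enorm B (y - z) ^+ 2.
Proof.
move=> mplus sy; have := hgm_model_three_points z yplus y mplus sy.
have := hgm_model_upper z yplus; have := hgm_model_lower z y; lra.
Qed.

(** The model at [yplus] is at most its value at parameter [t] on the segment from [z] to [y], where
    convexity bounds the linear term. *)
Lemma hgm_step_descent z yplus y t :
  is_argmin (slice K c) (hgm_model B rho beta z) yplus ->
  slice K c z -> slice K c y -> 0 <= t -> t <= 1 ->
  Num.sqrt (rho yplus) <= (1 - t) * Num.sqrt (rho z) + t * Num.sqrt (rho y)
    + t ^+ 2 * (3 * beta * enorm B (y - z) ^+ 2).
Proof.
move=> [splus minplus] sz sy t0 t1.
have := minplus _ (slice_segment K c z y t coneK sz sy t0 t1).
have := hgm_model_upper z yplus.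
have := sqrt_rho_convex z (y - z); rewrite [z + _]addrC subrK => cvx.
have : 0 <= t * (Num.sqrt (rho y) - (Num.sqrt (rho z) +
   (2 * Num.sqrt (rho z))^-1 * dotv (gradient rho z) (y - z))).
  by rewrite mulr_ge0// subr_ge0.
rewrite {3}/hgm_model [z + _]addrC addrK dotvZr sqr_enormZ//; lra.
Qed.


(** * Back from the homogenized problem to the original one *)

Let rho_pos y : slice K c y -> 0 < rho y.
Proof. by move=> sy; exact/rho_gt0/slice_neq0. Qed.

Lemma rhoZ t x : rho (t *: x) = t ^+ 4 * rho x.
Proof.
have [[Q [linQ symQ rhoQ]] _] := rho_quartic.
have rhoE y : rho y = eval4 Q y y y y by rewrite rhoQ eval4_diag.
have := eval4_expand Q x x t 0 t 0 linQ symQ.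
rewrite !scale0r !addr0 -!rhoE => ->; ring.
Qed.

Lemma cbrt_cubed (r : R) : 0 <= r -> (r `^ 3^-1) ^+ 3 = r.
Proof.
by move=> r0; rewrite -powR_mulrn ?powR_ge0// -powRrM mulVf// powRr1.
Qed.

(** The output minimizes along the ray of [y]: [r^4 rho(y) - r] is least at [r = (4 rho(y))^(-1/3)],
    with value [- (3/4) r]. *)
Lemma objective_output y : slice K c y ->
  objective rho c (hgm_output rho y) = - (3 / 4) / (4 * rho y) `^ 3^-1.
Proof.
move=> sy; have r0 := rho_pos _ sy; have [_ cy] := sy.
rewrite /objective /hgm_output rhoZ dotvZr cy mulr1.
set s := (4 * rho y) `^ 3^-1.
have s0 : 0 < s by rewrite powR_gt0// mulr_gt0.
have s3 : rho y = s ^+ 3 / 4 by rewrite cbrt_cubed ?mulr_ge0 ?ltW//; field.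
by rewrite s3; field; rewrite gt_eqF.
Qed.

Lemma output_in_cone y : slice K c y -> K (hgm_output rho y).
Proof.
by move=> [Ky _]; case: coneK => _ _; apply => //; rewrite invr_ge0 powR_ge0.
Qed.

(** One inequality tests [xstar] against the output at [ystar]; the other rescales [xstar] to the
    slice. *)
Lemma objective_xstar xstar ystar :
  is_argmin K (objective rho c) xstar ->
  is_argmin (slice K c) (fun y => Num.sqrt (rho y)) ystar ->
  objective rho c xstar = - (3 / 4) / (4 * rho ystar) `^ 3^-1.
Proof.
move=> [Kx minx] [sy miny]; have r0 := rho_pos _ sy.
have := minx _ (output_in_cone _ sy); rewrite objective_output//.
set s := (4 * rho ystar) `^ 3^-1 => le_obj.
have s0 : 0 < s by rewrite powR_gt0// mulr_gt0.
have sV0 : 0 < s^-1 by rewrite invr_gt0.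
have s3 : rho ystar = s ^+ 3 / 4 by rewrite cbrt_cubed ?mulr_ge0 ?ltW//; field.
apply/eqP; rewrite eq_le le_obj/=; rewrite /objective in le_obj *.
have rx0 : 0 <= rho xstar by exact: rho_ge0.
pose t := dotv c xstar; rewrite -/t in le_obj *.
have t0 : 0 < t by lra.
pose w := t^-1 *: xstar.
have sw : slice K c w.
  split; first by case: coneK => _ _; apply => //; rewrite invr_ge0 ltW.
  by rewrite dotvZr mulVf// gt_eqF.
have rw : rho ystar <= rho w.
  by have := miny w sw; rewrite ler_sqrt// ltW// rho_pos.
have -> : rho xstar = t ^+ 4 * rho w.
  by rewrite -rhoZ /w scalerA mulfV ?scale1r// gt_eqF.
have : t ^+ 4 * rho ystar <= t ^+ 4 * rho w.
  by rewrite ler_wpM2l// exprn_ge0// ltW.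
pose u := t * s.
have tu : t = u / s by rewrite /u mulfK// gt_eqF.
have -> : t ^+ 4 * rho ystar = u ^+ 4 / 4 / s.
  by rewrite tu s3; field; rewrite gt_eqF.
(* This product is [u^4 - 4 u + 3]; divided by [4 s] it is the remaining gap. *)
have : 0 <= ((u - 1) ^+ 2 * ((u + 1) ^+ 2 + 2)) * s^-1.
  by rewrite mulr_ge0 ?(ltW sV0)// mulr_ge0 ?sqr_ge0// addr_ge0 ?sqr_ge0.
rewrite tu; lra.
Qed.

(** The accuracy is [1 - 1 / v] with [v^3 = rho y / rho ystar] and [v >= 1], so it is at most
    [v - 1 <= v^(3/2) - 1]. *)
Lemma rel_accuracy_le xstar ystar y :
  is_argmin K (objective rho c) xstar ->
  is_argmin (slice K c) (fun y => Num.sqrt (rho y)) ystar -> slice K c y ->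
  rel_accuracy rho c (hgm_output rho y) xstar <= 1 /\
  rel_accuracy rho c (hgm_output rho y) xstar
    <= Num.sqrt (rho y / rho ystar) - 1.
Proof.
move=> mx my sy; have r0 := rho_pos _ sy.
have r1 : 0 < rho ystar by case: (my) => sstar _; exact: rho_pos.
rewrite /rel_accuracy (objective_xstar _ _ mx my) objective_output//.
set s := (4 * rho y) `^ 3^-1; set s' := (4 * rho ystar) `^ 3^-1.
have s0 : 0 < s by rewrite powR_gt0// mulr_gt0.
have s'0 : 0 < s' by rewrite powR_gt0// mulr_gt0.
have s3 : rho y = s ^+ 3 / 4 by rewrite cbrt_cubed ?mulr_ge0 ?ltW//; field.
have s'3 : rho ystar = s' ^+ 3 / 4.
  by rewrite cbrt_cubed ?mulr_ge0 ?ltW//; field.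
rewrite !mulNr normrN gtr0_norm ?divr_gt0//.
have -> : (- (3 / 4 / s) - - (3 / 4 / s')) / (3 / 4 / s') = 1 - s' / s.
  by field; rewrite !gt_eqF.
split; first by rewrite gerBl divr_ge0// ltW.
pose v := s / s'; have v0 : 0 < v by rewrite divr_gt0.
have -> : s' / s = v^-1 by rewrite invf_div.
have rE : rho y / rho ystar = v ^+ 3.
  by rewrite s3 s'3 /v; field; rewrite gt_eqF.
rewrite rE; set q := Num.sqrt _.
have q0 : 0 <= q by rewrite sqrtr_ge0.
have q2 : q ^+ 2 = v ^+ 3 by rewrite sqr_sqrtr// exprn_ge0// ltW.
have v1 : 1 <= v.
  rewrite -(@ler_pXn2r _ 3) ?nnegrE ?(ltW v0)// expr1n -rE.
  case: my => _ /(_ y sy); rewrite ler_sqrt ?(ltW r0)// => ryy.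
  by rewrite ler_pdivlMr// mul1r.
have vq : v <= q.
  rewrite -(@ler_pXn2r _ 2) ?nnegrE ?(ltW v0)// q2 (exprS v 2).
  by rewrite ler_peMl// sqr_ge0.
have : 0 <= (v - 1) ^+ 2 * v^-1 by rewrite mulr_ge0 ?sqr_ge0// invr_ge0 ltW.
have -> : (v - 1) ^+ 2 * v^-1 = v - 2 + v^-1 by field; rewrite gt_eqF.
lra.
Qed.


(** * Relative excess along a run *)

Variable ystar : V.
Hypothesis ystar_min : is_argmin (slice K c) (fun y => Num.sqrt (rho y)) ystar.
Variables (y0 : V) (N : nat) (y : nat -> V).
Hypothesis run_y : hgm_run B rho beta K c y0 N y.

Local Notation F := (fun x => Num.sqrt (rho x)).
Let kappa := beta / alpha.
Let eps (k : nat) := Num.sqrt (rho (y k) / rho ystar) - 1.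

Let Fstar_gt0 : 0 < F ystar.
Proof.
rewrite sqrtr_gt0; apply/rho_gt0/slice_neq0; by case: ystar_min.
Qed.

Let F_eps k : F (y k) = (1 + eps k) * F ystar.
Proof.
rewrite /eps addrC subrK sqrtrM; last exact: rho_ge0.
rewrite sqrtrV; last exact: rho_ge0.
by rewrite divfK// gt_eqF.
Qed.

Lemma hgm_run_slice k : (0 < k)%N -> (k <= N)%N -> slice K c (y k).
Proof. by case: k => // k _ kN; case: run_y => _ /(_ k kN)[]. Qed.

Lemma hgm_excess_ge0 k : slice K c (y k) -> 0 <= eps k.
Proof.
move=> sk; case: ystar_min => _ /(_ _ sk); rewrite F_eps => h.
have : 0 <= eps k * F ystar by lra.
by rewrite pmulr_lge0.
Qed.

Lemma hgm_excess_nonincreasing k : slice K c (y k) -> (k < N)%N ->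
  eps k.+1 <= eps k.
Proof.
move=> sk kN; have [_ /(_ k kN) mk] := run_y.
have sstar : slice K c ystar by case: ystar_min.
have := hgm_step_descent (y k) (y k.+1) ystar 0 mk sk sstar (lexx _) ler01.
rewrite expr0n/= !mul0r !addr0 subr0 mul1r !F_eps ler_pM2r//; lra.
Qed.

Lemma hgm_excess_sublinear k : (k <= N)%N ->
  k%:R * eps k <= 6 * kappa * (2 + eps 0).
Proof.
move=> kN.
pose D j := 3 * beta * enorm B (ystar - y j) ^+ 2.
have D_ge0 j : 0 <= D j by rewrite mulr_ge0 ?sqr_ge0// mulr_ge0// ltW.
have sstar : slice K c ystar by case: ystar_min.
(* The three-point inequality at [ystar] reads [eps_(k+1) F(ystar) + D_(k+1) <= D_k] and
   telescopes. *)
have key : k%:R * (eps k * F ystar) + D k <= D 0%N.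
  elim: k kN => [_|k ih kN]; first by rewrite mul0r add0r.
  have {}ih := ih (ltnW kN); have [_ /(_ k kN) mk] := run_y.
  have := hgm_step_three_points (y k) (y k.+1) ystar mk sstar.
  rewrite F_eps -/(D k) -/(D k.+1) => tp.
  (* At [k = 0] the factor vanishes, so monotonicity is invoked only at feasible iterates. *)
  have : k%:R * (eps k.+1 * F ystar) <= k%:R * (eps k * F ystar).
    case: k kN mk ih tp => [|k] kN *; first by rewrite !mul0r.
    rewrite ler_wpM2l// ler_pM2r//; apply: hgm_excess_nonincreasing => //.
    by apply: hgm_run_slice => //; exact: ltnW.
  rewrite -[k.+1%:R]natr1; lra.
have aE : alpha * kappa = beta by rewrite /kappa mulrC divfK// gt_eqF.
have k0 : 0 < kappa by rewrite divr_gt0.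
(* Here [2 + eps 0] arises as [F ystar + F (y 0)] in units of [F ystar]. *)
have D0 : D 0%N <= 6 * kappa * (2 + eps 0) * F ystar.
  have d0 := sqr_enormB_le B saB pdB ystar (y 0%N).
  have : D 0%N <=
      3 * beta * (2 * enorm B ystar ^+ 2 + 2 * enorm B (y 0%N) ^+ 2).
    by rewrite ler_pM2l// mulr_gt0.
  have h z := sqrt_rho_ge z.
  have {}h z : beta * enorm B z ^+ 2 <= kappa * F z.
    by rewrite -aE (mulrC alpha) -mulrA ler_pM2l.
  have := h ystar; have := h (y 0%N); rewrite F_eps; move: d0; lra.
rewrite -(ler_pM2r Fstar_gt0); have := D_ge0 k; lra.
Qed.

Lemma hgm_excess_step k t : slice K c (y k) -> (k < N)%N -> 0 <= t -> t <= 1 ->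
  eps k.+1 <= (1 - t) * eps k +
    t ^+ 2 * (15 * kappa * Num.max (eps k) (Num.sqrt (eps k))).
Proof.
move=> sk kN t0 t1; have [_ /(_ k kN) mk] := run_y.
have sstar : slice K c ystar by case: ystar_min.
have e0 := hgm_excess_ge0 k sk.
set s := Num.sqrt (eps k); set M := Num.max _ _.
have s0 : 0 <= s by rewrite sqrtr_ge0.
have es : eps k = s ^+ 2 by rewrite sqr_sqrtr.
have M0 : 0 <= M by rewrite le_max e0.
have := hgm_step_descent (y k) (y k.+1) ystar t mk sk sstar t0 t1.
have -> : enorm B (ystar - y k) ^+ 2 = enorm B (y k - ystar) ^+ 2.
  by rewrite -[ystar - _]opprB -scaleN1r sqr_enormZ// sqrrN expr1n mul1r.
set h := enorm B _ ^+ 2.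
have h0 : 0 <= h by rewrite sqr_ge0.
have growth := quartic_growth ystar (y k) ystar_min sk.
have r_ge0 x : 0 <= rho x by exact: rho_ge0.
have rE x : rho x = F x ^+ 2 by rewrite sqr_sqrtr.
(* Quartic growth bounds [(alpha h)^2] by [8 eps (2 + eps) F(ystar)^2], at most [24 M^2 F(ystar)^2];
   rounding 24 up to 25 gives 5, and 15 after the factor 3 of the model. *)
have hM : alpha * h <= 5 * M * F ystar.
  rewrite -(@ler_pXn2r _ 2) ?nnegrE ?mulr_ge0 ?(ltW alpha_gt0) ?sqrtr_ge0//.
  have : (alpha * h) ^+ 2 <= rho (y k - ystar).
    by rewrite exprMn -exprM; case/andP: (rho_bounds (y k - ystar)).
  move=> /le_trans; apply.
  have : eps k * (2 + eps k) <= 3 * M ^+ 2.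
    rewrite /M; have [se|se] := leP (eps k) s.
      by rewrite es; have := se; rewrite es; nra.
    have : s <= s ^+ 2 by rewrite -es ltW.
    rewrite es; nra.
  move=> eM.
  have : (eps k * (2 + eps k)) * F ystar ^+ 2 <= 3 * M ^+ 2 * F ystar ^+ 2.
    by rewrite ler_wpM2r// sqr_ge0.
  have : F ystar ^+ 2 + rho (y k - ystar) / 8 <= ((1 + eps k) * F ystar) ^+ 2.
    by rewrite -F_eps -!rE.
  have : 0 <= (M * F ystar) ^+ 2 by exact: sqr_ge0.
  lra.
have kh : kappa * (alpha * h) <= kappa * (5 * M * F ystar).
  by rewrite ler_pM2l// divr_gt0.
have {}kh : beta * h <= kappa * (5 * M * F ystar).
  by apply: le_trans kh; rewrite mulrA /kappa divfK// gt_eqF.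
have : t ^+ 2 * (beta * h) <= t ^+ 2 * (kappa * (5 * M * F ystar)).
  by rewrite ler_wpM2l// sqr_ge0.
rewrite !F_eps => th Fle; rewrite -(ler_pM2r Fstar_gt0); lra.
Qed.

End homogenized_gradient_method.

Theorem theorem4p6 (R : realType) :
  exists2 C : R, 0 < C &
  forall (n : nat) (B : {linear 'rV[R]_n -> 'rV[R]_n})
    (K : set 'rV[R]_n) (c : 'rV[R]_n) (rho : 'rV[R]_n -> R)
    (alpha beta : R) (xstar ystar y0 : 'rV[R]_n) (delta : R),
  self_adjoint B ->
  positive_definite B ->
  closed_convex_cone K ->
  c != 0 ->
  (exists2 x, K x & 0 < dotv c x) ->
  convex_quartic_form rho ->
  0 < alpha -> alpha <= beta ->
  (forall x, alpha ^+ 2 * enorm B x ^+ 4 <= rho x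
             <= beta ^+ 2 * enorm B x ^+ 4) ->
  is_argmin K (objective rho c) xstar ->
  is_argmin (slice K c) (fun y => Num.sqrt (rho y)) ystar ->
  0 < delta ->
  let kappa := beta / alpha in
  let delta0 := Num.sqrt (rho y0 / rho ystar) - 1 in
  forall (N : nat) (y : nat -> 'rV[R]_n),
  hgm_run B rho beta K c y0 N y ->
  (* feasible y0: the bound verbatim, with a possibly negative logarithm *)
  (slice K c y0 ->
   C * (kappa * (ln (delta0 / delta) + Num.sqrt (1 / delta))) <= N%:R ->
   rel_accuracy rho c (hgm_output rho (y N)) xstar <= delta) /\
  (* arbitrary y0: the logarithm counts only where it is nonnegative *)
  (C * (kappa * (Num.max 0 (ln (delta0 / delta)) + Num.sqrt (1 / delta)))
     <= N%:R ->
   rel_accuracy rho c (hgm_output rho (y N)) xstar <= delta).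

Proof.
exists 300; first by rewrite ltr0n.
move=> n B K c rho alpha beta xstar ystar y0 delta saB pdB coneK _ _ rhoQ a0 ab.
move=> bounds xmin ymin d0 kappa delta0 N y run.
have b0 : 0 < beta by exact: lt_le_trans ab.
have k1 : 1 <= kappa by rewrite /kappa ler_pdivlMr// mul1r.
have y0E : y 0%N = y0 by case: run.
pose eps k := Num.sqrt (rho (y k) / rho ystar) - 1.
have eps0 : eps 0%N = delta0 by rewrite /eps y0E.
have slN k : (0 < k)%N -> (k <= N)%N -> slice K c (y k).
  exact: (hgm_run_slice _ _ _ _ _ _ _ _ run).
have acc k : slice K c (y k) ->
    rel_accuracy rho c (hgm_output rho (y k)) xstar <= 1 /\
    rel_accuracy rho c (hgm_output rho (y k)) xstar <= eps k.
  exact: (rel_accuracy_le B rho alpha beta).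
have mono k : slice K c (y k) -> (k < N)%N -> eps k.+1 <= eps k.
  exact: (hgm_excess_nonincreasing B rho alpha beta pdB rhoQ a0 b0 bounds
    K c coneK ystar ymin y0 N y run).
have main : 300 * (kappa * (Num.max 0 (ln (delta0 / delta))
    + Num.sqrt (1 / delta))) <= N%:R ->
    rel_accuracy rho c (hgm_output rho (y N)) xstar <= delta.
  move=> NC.
  (* At least one step is needed to place [y N] on the slice when [y0] is infeasible. *)
  have N0 : (0 < N)%N.
    rewrite -(ltr_nat R); apply: lt_le_trans NC.
    apply: mulr_gt0; first by rewrite ltr0n.
    apply: mulr_gt0; first exact: lt_le_trans k1.
    by rewrite ltr_wpDl ?le_max ?lexx// sqrtr_gt0 divr_gt0.
  have [acc1 accN] := acc N (slN N N0 (leqnn _)).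
  (* For [delta >= 1] any feasible iterate will do. *)
  have [d1|d1] := leP 1 delta; first exact: le_trans d1.
  apply: le_trans accN _.
  apply: (@iteration_count R kappa delta delta0 eps N) => // k.
  - by move=> k0 kN; apply: mono => //; apply: slN => //; exact: ltnW.
  - move=> k0 kN; rewrite -eps0.
    exact: (hgm_excess_sublinear B rho alpha beta saB pdB rhoQ a0 b0 bounds
      K c coneK ystar ymin y0 N y run).
  - move=> t k0 kN _ t0 t1.
    apply: (hgm_excess_step B rho alpha beta pdB rhoQ a0 b0 bounds
      K c coneK ystar ymin y0 N y run) => //.
    by apply: slN => //; exact: ltnW.
split; last exact: main.
(* If [delta0 <= delta], the logarithm may be negative and [N] small, but monotonicity from the
   feasible start suffices. Otherwise the logarithm is nonnegative and both bounds coincide. *)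
move=> s0 NC; have [d1|d1] := leP delta0 delta.
  have sl k : (k <= N)%N -> slice K c (y k).
    by case: k => [_|k]; [rewrite y0E|exact: slN].
  have [_ /le_trans] := acc N (sl N (leqnn _)); apply.
  have : forall k, (k <= N)%N -> eps k <= delta.
    elim=> [_|k ih kN]; first by rewrite eps0.
    by apply: le_trans (mono k (sl k (ltnW kN)) kN) (ih (ltnW kN)).
  exact.
apply: main; rewrite (max_idPr _)// ln_ge0// ler_pdivlMr// mul1r; exact: ltW.
Qed.
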